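(* Let $(X,\mathcal{T},E)$ and $(Y,\mathcal{S},E')$ be soft topological spaces and let $f:(X,\mathcal{T},E)\to(Y,\mathcal{S},E')$ be a soft function. The following are equivalent: (1) $f$ is soft $sw$-continuous; (2) $f^{-1}(F_{E'})$ is a soft $sw$-closed set over $X$ for each soft closed set $F_{E'}$ over $Y$; (3) $f(\mathrm{Cl}_{sw}(G_E))\sqsubseteq\mathrm{Cl}(f(G_E))$ for each soft set $G_E$ over $X$; (4) $\mathrm{Cl}_{sw}(f^{-1}(H_{E'}))\sqsubseteq f^{-1}(\mathrm{Cl}(H_{E'}))$ for each soft set $H_{E'}$ over $Y$; (5) $f^{-1}(\mathrm{Int}(H_{E'}))\sqsubseteq\mathrm{Int}_{sw}(f^{-1}(H_{E'}))$ for each soft set $H_{E'}$ over $Y$.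
   Context: A soft set $F_E$ over a set $X$ with parameter set $E$ is a map $F:E\to\mathcal{P}(X)$. The null soft set $\Phi_E$ has all values $\emptyset$; the absolute soft set $X_E$ has all values $X$. Inclusion $\sqsubseteq$, union $\sqcup$, intersection $\sqcap$ and complement are taken parameterwise. A soft topology $\mathcal{T}$ on $X$ is a family of soft sets over $X$ (with parameters $E$) containing $\Phi_E$ and $X_E$ and closed under finite intersections and arbitrary unions; $(X,\mathcal{T},E)$ is a soft topological space, members of $\mathcal{T}$ are soft open and their complements are soft closed. $\mathrm{Int}(F_E)$ is the largest soft open set contained in $F_E$ and $\mathrm{Cl}(F_E)$ the smallest soft closed set containing $F_E$. A soft function $f$ from $X$ (parameters $E$) to $Y$ (parameters $E'$) is given by maps $u:X\to Y$ and $p:E\to E'$; $f(F_E)(e')=\bigcup_{e\in p^{-1}(e')}u(F(e))$ for $e'\in E'$, and $f^{-1}(G_{E'})(e)=u^{-1}(G(p(e)))$ for $e\in E$. A soft set $G_E$ is soft $sw$-open (soft somewhat open) if $G_E=\Phi_E$ or $\mathrm{Int}(G_E)\neq\Phi_E$; complements of soft $sw$-open sets are soft $sw$-closed (i.e. $F_E$ is soft $sw$-closed iff $F_E=X_E$ or $\mathrm{Cl}(F_E)\neq X_E$). $\mathrm{Cl}_{sw}(G_E)$ is the soft intersection of all soft $sw$-closed sets over $X$ containing $G_E$; $\mathrm{Int}_{sw}(G_E)$ is the soft union of all soft $sw$-open sets over $X$ contained in $G_E$. The soft function $f$ is soft $sw$-continuous if $f^{-1}(V_{E'})$ is soft $sw$-open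 over $X$ for each soft open set $V_{E'}$ over $Y$. *)

(* Defs.v *)
From mathcomp Require Import all_boot.
From mathcomp Require Import boolp classical_sets.

Set Implicit Arguments.
Unset Strict Implicit.
Unset Printing Implicit Defensive.

Local Open Scope classical_set_scope.

Definition softset (X E : Type) : Type := E -> set X.

Section SoftSetOperations.
Variables X E : Type.
Implicit Types F G : softset X E.

Definition soft_null : softset X E := fun _ => set0.
Definition soft_absolute : softset X E := fun _ => setT.

Definition soft_subset F G : Prop := forall e, F e `<=` G e.
Definition soft_setI F G : softset X E := fun e => F e `&` G e.
Definition soft_setC F : softset X E := fun e => ~` F e.

(* The union of the empty family is the null soft set and the intersection of
   the empty family is the absolute soft set. *)
Definition soft_bigcup (A : set (softset X E)) : softset X E :=
  fun e => \bigcup_(F in A) F e.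
Definition soft_bigcap (A : set (softset X E)) : softset X E :=
  fun e => \bigcap_(F in A) F e.

End SoftSetOperations.

Arguments soft_null {X E}.
Arguments soft_absolute {X E}.

Declare Scope soft_scope.
Delimit Scope soft_scope with soft.
Notation "F [<=] G" := (soft_subset F G) (at level 70) : soft_scope.
Local Open Scope soft_scope.

(* Closure under finite intersections is given by the nullary case
   [soft_open_absolute] and the binary case [soft_open_setI]. *)
Record softTopology (X E : Type) := SoftTopology {
  soft_open : set (softset X E);
  soft_open_null : soft_open soft_null;
  soft_open_absolute : soft_open soft_absolute;
  soft_open_setI : forall F G : softset X E,
    soft_open F -> soft_open G -> soft_open (soft_setI F G);
  soft_open_bigcup : forall A : set (softset X E),
    A `<=` soft_open -> soft_open (soft_bigcup A)
}.

Section SoftTopologyNotions.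
Variables (X E : Type) (T : softTopology X E).
Implicit Types F G : softset X E.

Definition soft_closed F : Prop := soft_open T (soft_setC F).

Definition soft_Int F : softset X E :=
  soft_bigcup [set G | soft_open T G /\ G [<=] F].
Definition soft_Cl F : softset X E :=
  soft_bigcap [set G | soft_closed G /\ F [<=] G].

Definition soft_sw_open F : Prop := F = soft_null \/ soft_Int F <> soft_null.
Definition soft_sw_closed F : Prop := soft_sw_open (soft_setC F).

Definition soft_Int_sw F : softset X E :=
  soft_bigcup [set G | soft_sw_open G /\ G [<=] F].
Definition soft_Cl_sw F : softset X E :=
  soft_bigcap [set G | soft_sw_closed G /\ F [<=] G].

Lemma soft_Int_largest F :
  [/\ soft_open T (soft_Int F), soft_Int F [<=] F &
      forall G, soft_open T G -> G [<=] F -> G [<=] soft_Int F].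
Proof.
split.
- by apply: soft_open_bigcup => G [].
- by move=> e x [G [_ GF] /GF].
- by move=> G oG GF e x Gx; exists G.
Qed.

Lemma soft_Cl_smallest F :
  [/\ soft_closed (soft_Cl F), F [<=] soft_Cl F &
      forall G, soft_closed G -> F [<=] G -> soft_Cl F [<=] G].
Proof.
split.
- rewrite /soft_closed.
  have -> : soft_setC (soft_Cl F) =
      soft_bigcup [set G | soft_open T G /\ F [<=] soft_setC G].
    apply/funext => e; rewrite /soft_setC /soft_Cl /soft_bigcap setC_bigcap.
    apply/seteqP; split=> x [G [cG FG] nGx].
      exists (soft_setC G) => //; split=> // e' y /FG Gy; exact.
    exists (soft_setC G); last by move=> /(_ nGx).
    split=> //; rewrite /soft_closed.
    suff -> : soft_setC (soft_setC G) = G by [].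
    by apply/funext => e'; rewrite /soft_setC setCK.
  by apply: soft_open_bigcup => G [].
- by move=> e x Fx G [_ FG]; apply: FG.
- by move=> G cG FG e x; apply.
Qed.

Lemma soft_sw_closedE F :
  soft_sw_closed F <-> F = soft_absolute \/ soft_Cl F <> soft_absolute.
Proof.
have CK (G : softset X E) : soft_setC (soft_setC G) = G.
  by apply/funext => e; rewrite /soft_setC setCK.
have C0 : soft_setC soft_null = soft_absolute :> softset X E.
  by apply/funext => e; rewrite /soft_setC setC0.
have IntC : soft_Int (soft_setC F) = soft_setC (soft_Cl F).
  apply/funext => e; rewrite /soft_setC /soft_Cl /soft_bigcap setC_bigcap.
  apply/seteqP; split=> x [G [oG GF] Gx].
    exists (soft_setC G); last by move=> /(_ Gx).
    split; first by rewrite /soft_closed CK.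
    by move=> e' y Fy /GF; apply.
  exists (soft_setC G) => //; split=> // e' y nGy Fy; exact/nGy/GF.
rewrite /soft_sw_closed /soft_sw_open IntC.
have CE (G : softset X E) : soft_setC G = soft_null <-> G = soft_absolute.
  split=> [GE|->]; first by rewrite -(CK G) GE C0.
  by rewrite -C0 CK.
by rewrite !(propext (CE _)).
Qed.

End SoftTopologyNotions.

Record softFunction (X E Y E' : Type) := SoftFunction {
  soft_fun_map : X -> Y;
  soft_fun_param : E -> E'
}.

Section SoftFunctions.
Variables (X E Y E' : Type) (f : softFunction X E Y E').

Definition soft_image (F : softset X E) : softset Y E' :=
  fun e' => \bigcup_(e in soft_fun_param f @^-1` [set e'])
              (soft_fun_map f @` F e).

Definition soft_preimage (G : softset Y E') : softset X E :=
  fun e => soft_fun_map f @^-1` G (soft_fun_param f e).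

Definition soft_sw_continuous (T : softTopology X E) (S : softTopology Y E') :
    Prop :=
  forall V : softset Y E', soft_open S V -> soft_sw_open T (soft_preimage V).

End SoftFunctions.

(* Main.v *)
Require Import Defs.
From mathcomp Require Import all_boot.
From mathcomp Require Import boolp classical_sets.

(** A union of soft [sw]-open sets is again soft [sw]-open: unless it is null,
    it contains a member with a non-null interior.  Hence [soft_Int_sw F] is
    soft [sw]-open ([soft_sw_open_Int_sw]), although soft [sw]-open sets need
    not form a soft topology.  The equivalences then follow as for continuous
    maps.  Preimages commute with complements and are right adjoint to images
    ([soft_image_subset]); this takes [sw]-continuity to the condition on soft
    closed sets and then to the two conditions on closures.  The duality
    between [soft_Cl_sw] and [soft_Int_sw] yields the condition on interiors.
    For a soft open [V], that last condition says that the preimage of [V]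
    equals its own soft [sw]-interior, hence is soft [sw]-open. *)

Local Open Scope soft_scope.

Section SoftSets.
Variables X E : Type.
Implicit Types F G : softset X E.

Lemma soft_setCK F : soft_setC (soft_setC F) = F.
Proof. by apply/funext => e; rewrite /soft_setC setCK. Qed.

Lemma soft_subset_anti F G : F [<=] G -> G [<=] F -> F = G.
Proof. by move=> FG GF; apply/funext => e; apply/seteqP; split; auto. Qed.

Lemma soft_subset_null F : F [<=] soft_null -> F = soft_null.
Proof. by move=> F0; apply: soft_subset_anti => // e x []. Qed.

End SoftSets.

Section SoftSwOpen.
Variables (X E : Type) (T : softTopology X E).
Implicit Types F G : softset X E.

Lemma soft_Int_subset F G : F [<=] G -> soft_Int T F [<=] soft_Int T G.
Proof.
by move=> FG e x [O [oO OF] Ox]; exists O => //; split=> // e' y /OF /FG.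
Qed.

Lemma soft_sw_open_bigcup (A : set (softset X E)) :
  subset A (soft_sw_open T) -> soft_sw_open T (soft_bigcup A).
Proof.
move=> Asw; have [A0|AN0] := EM (forall F, A F -> F = soft_null).
  left; apply: soft_subset_null => e x.
  by case=> F AF; rewrite (A0 F AF).
right; apply: contra_not AN0 => IA0 F AF.
have [//|IF] := Asw F AF; case: IF.
apply: soft_subset_null => e x IFx.
suff: soft_Int T (soft_bigcup A) e x by rewrite IA0.
by apply: soft_Int_subset IFx => e' y Fy; exists F.
Qed.

Lemma soft_sw_open_Int_sw F : soft_sw_open T (soft_Int_sw T F).
Proof. by apply: soft_sw_open_bigcup => G []. Qed.

(** One half of the duality between soft [sw]-interior and soft
    [sw]-closure. *)
Lemma soft_setC_Cl_sw_setC F :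
  soft_setC (soft_Cl_sw T (soft_setC F)) [<=] soft_Int_sw T F.
Proof.
move=> e x nCx; apply: contrapT => nIx; apply: nCx => G [cG FG].
apply: contrapT => nGx; apply: nIx; exists (soft_setC G) => //.
by split=> // e' y nGy; apply: contrapT => nFy; apply: nGy; exact: FG.
Qed.

End SoftSwOpen.

Section SoftFunctions.
Variables (X E Y E' : Type) (f : softFunction X E Y E').

Lemma soft_image_subset (G : softset X E) (H : softset Y E') :
  soft_image f G [<=] H <-> G [<=] soft_preimage f H.
Proof.
split=> [GH e x Gx|GH e' y [e <- [x Gx <-]]]; last exact: GH.
by apply: GH; exists e => //; exists x.
Qed.

End SoftFunctions.

Theorem proposition4p1 (X E Y E' : Type)
    (T : softTopology X E) (S : softTopology Y E')
    (f : softFunction X E Y E') :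
  [<-> soft_sw_continuous f T S;
       forall F : softset Y E',
         soft_closed S F -> soft_sw_closed T (soft_preimage f F);
       forall G : softset X E,
         soft_image f (soft_Cl_sw T G) [<=] soft_Cl S (soft_image f G);
       forall H : softset Y E',
         soft_Cl_sw T (soft_preimage f H) [<=] soft_preimage f (soft_Cl S H);
       forall H : softset Y E',
         soft_preimage f (soft_Int S H) [<=] soft_Int_sw T (soft_preimage f H)].
Proof.
tfae.
- by move=> fc F cF; exact: fc cF.
- move=> fcl G; apply/soft_image_subset => e x; apply.
  have [cC GC _] := soft_Cl_smallest S (soft_image f G).
  by split; [exact: fcl | exact/soft_image_subset].
- move=> fCl H; apply/soft_image_subset => e' y /fCl Cy F [cF HF].
  apply: Cy; split=> //.
  by apply/soft_image_subset => e x; exact: HF.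
- move=> Clf H e x [O [oO OH] Ox]; apply: soft_setC_Cl_sw_setC => Cx.
  (* The complement of [O] is a soft closed set containing that of [H]. *)
  have := Clf (soft_setC H) e x Cx (soft_setC O); apply=> //.
  split; first by rewrite /soft_closed soft_setCK.
  by move=> e' y nHy /OH.
- move=> fInt V oV.
  suff -> : soft_preimage f V = soft_Int_sw T (soft_preimage f V).
    exact: soft_sw_open_Int_sw.
  apply: soft_subset_anti => e x; last by case=> G [_ GV] /GV.
  by move=> Vx; apply: fInt; exists V => //; split=> // e' y.
Qed.
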